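(* Let $\mathcal{X}\subset\mathbb{R}^{n_x}$, $\mathcal{Y}\subset\mathbb{R}^{n_y}$ and payoff functions $f_t:\mathcal{X}\times\mathcal{Y}\to\mathbb{R}$, $t=0,1,2,\ldots$, satisfy the standing assumptions (A1)–(A4) listed in the context. Suppose that the Nash equilibria $(x_t^*,y_t^* )$ of $f_t$ remain uniformly in the interior of $\mathcal{X}\times\mathcal{Y}$, i.e. $$\delta_{\mathcal{X}}=\inf_{t\ge0}\mathrm{dist}(x_t^*,\partial\mathcal{X})>0,\qquad \delta_{\mathcal{Y}}=\inf_{t\ge0}\mathrm{dist}(y_t^*,\partial\mathcal{Y})>0$$ (with every $x_t^*$ in the interior of $\mathcal{X}$ and every $y_t^*$ in the interior of $\mathcal{Y}$). Put $$C=L_xD_{\mathcal{X}}^2+L_yD_{\mathcal{Y}}^2+(L_{xy}+L_{yx})D_{\mathcal{X}}D_{\mathcal{Y}},\qquad \nu=1-\frac{\sqrt2\,\max\{D_{\mathcal{X}}L_{xy}/\sqrt{\mu_y},\;D_{\mathcal{Y}}L_{yx}/\sqrt{\mu_x}\}}{\min\{\sqrt{\mu_y}\,\delta_{\mathcal{Y}},\;\sqrt{\mu_x}\,\delta_{\mathcal{X}}\}},$$ and suppose $\nu>0$. Let $\rho\in(0,1)$, let $(x_0,y_0)\in\mathcal{X}\times\mathcal{Y}$, and let $\{(x_t,y_t)\}_{t\ge0}$ be generated by the online Frank–Wolfe algorithm: for $t\ge0$, $$r_t^x=\nabla_xf_t(x_t,y_t),\quad r_t^y=\nabla_yf_t(x_t,y_t),\quad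 s_t^x\in\arg\min_{x\in\mathcal{X}}\langle r_t^x,x\rangle,\quad s_t^y\in\arg\max_{y\in\mathcal{Y}}\langle r_t^y,y\rangle,$$ $$g_t^x=\langle r_t^x,x_t-s_t^x\rangle,\quad g_t^y=-\langle r_t^y,y_t-s_t^y\rangle,\quad g_t=g_t^x+g_t^y,\quad \eta_t=\frac{\nu g_t}{C},$$ $$x_{t+1}=(1-\eta_t)x_t+\eta_ts_t^x,\qquad y_{t+1}=(1-\eta_t)y_t+\eta_ts_t^y.$$ Then $\eta_t\in[0,1]$ for all $t\ge0$. Moreover, with $$\beta_{\rm FW}=1-\frac{\min\{\mu_y\delta_{\mathcal{Y}}^2,\mu_x\delta_{\mathcal{X}}^2\}\,\nu^2}{C},$$ one has $\beta_{\rm FW}\in(0,1)$; for all $t\ge0$, $$f_t(x_t,y_t^* )-f_t(x_t^*,y_t)\le\beta_{\rm FW}^t\big(f_0(x_0,y_0^* )-f_0(x_0^*,y_0)\big)+\sum_{i=1}^t\beta_{\rm FW}^{t-i}\Big(D_{\mathcal{X}}L_{yx}V_i^y+D_{\mathcal{Y}}L_{xy}V_i^x+\frac{L_y}2(V_i^y)^2+\frac{L_x}2(V_i^x)^2+2F_i^{\sup}\Big);$$ and for every $T\ge1$ the forgetting-factor game regret satisfies $$R_T^F\le\sum_{t=1}^T\rho^{T-t}\beta_{\rm FW}^t\big(f_0(x_0,y_0^* )-f_0(x_0^*,y_0)\big)+\sum_{i=1}^T\sum_{t=i}^T\rho^{T-t}\beta_{\rm FW}^{t-i}\Big(D_{\mathcal{X}}L_{yx}V_i^y+D_{\mathcal{Y}}L_{xy}V_i^x+\frac{L_y}2(V_i^y)^2+\frac{L_x}2(V_i^x)^2+2F_i^{\sup}\Big).$$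 If $V_t^x\to0$, $V_t^y\to0$ and $F_t^{\sup}\to0$ as $t\to\infty$, then $R_T^F\to0$ as $T\to\infty$.
   Context: $\|\cdot\|$ and $\langle\cdot,\cdot\rangle$ are the Euclidean norm and inner product; $\nabla_x f,\nabla_y f$ are partial gradients; $\partial\mathcal{X}$ is the boundary of $\mathcal{X}$. Standing assumptions. (A1) $\mathcal{X}$ and $\mathcal{Y}$ are nonempty, compact and convex; each $f_t$ is continuous and convex-concave on $\mathcal{X}\times\mathcal{Y}$ (convex in $x$ for each fixed $y$, concave in $y$ for each fixed $x$). (A2) There are $\mu_x,\mu_y>0$ such that each $f_t$ is $\mu_x$-strongly convex in $x$ for every fixed $y\in\mathcal{Y}$ and $\mu_y$-strongly concave in $y$ for every fixed $x\in\mathcal{X}$. (A3) Each $f_t$ is differentiable, and there are $L_x\ge\mu_x$, $L_y\ge\mu_y$ such that $\|\nabla_x f_t(x,y)-\nabla_x f_t(x',y)\|\le L_x\|x-x'\|$ and $\|\nabla_y f_t(x,y)-\nabla_y f_t(x,y')\|\le L_y\|y-y'\|$ for all $x,x'\in\mathcal{X}$, $y,y'\in\mathcal{Y}$, $t\ge0$. (A4) There are $L_{xy},L_{yx}>0$ such that $\|\nabla_x f_t(x,y)-\nabla_x f_t(x,y')\|\le L_{xy}\|y-y'\|$ and $\|\nabla_y f_t(x,y)-\nabla_y f_t(x',y)\|\le L_{yx}\|x-x'\|$ for all $x,x'\in\mathcal{X}$, $y,y'\in\mathcal{Y}$, $t\ge0$. A Nash equilibrium (NE) of $f_t$ is a pair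 $(x_t^*,y_t^* )\in\mathcal{X}\times\mathcal{Y}$ with $f_t(x_t^*,y)\le f_t(x_t^*,y_t^* )\le f_t(x,y_t^* )$ for all $(x,y)\in\mathcal{X}\times\mathcal{Y}$; under (A1)–(A2) it exists and is unique. Notation: $D_{\mathcal{X}}=\sup_{x,x'\in\mathcal{X}}\|x-x'\|$, $D_{\mathcal{Y}}=\sup_{y,y'\in\mathcal{Y}}\|y-y'\|$; for $t\ge1$, $V_t^x=\|x_t^*-x_{t-1}^*\|$, $V_t^y=\|y_t^*-y_{t-1}^*\|$, and $F_t^{\sup}=\sup_{(x,y)\in\mathcal{X}\times\mathcal{Y}}|f_t(x,y)-f_{t-1}(x,y)|$. Forgetting-factor game regret (for given $\rho\in(0,1)$): $R_T^F=\sum_{t=1}^T\rho^{T-t}\big(f_t(x_t,y_t^* )-f_t(x_t^*,y_t)\big)$. *)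

(* Defs.v *)
From HB Require Import structures.
From mathcomp Require Export all_boot all_order all_algebra.
From mathcomp Require Export interval_inference boolp classical_sets reals.
From mathcomp Require Export topology normedtype sequences convex.
#[export] Set Implicit Arguments.
#[export] Unset Strict Implicit.
#[export] Unset Printing Implicit Defensive.
Export Order.TTheory GRing.Theory Num.Theory.
Export numFieldNormedType.Exports.

Local Open Scope classical_set_scope.
Local Open Scope ring_scope.

Definition dotp (R : realType) (n : nat) (u v : 'rV[R]_n) : R :=
  \sum_(i < n) u 0 i * v 0 i.

(* The library norm `|u| on 'rV[R]_n is the sup norm, hence this one; the two
   induce the same topology. *)
Definition enorm (R : realType) (n : nat) (u : 'rV[R]_n) : R :=
  Num.sqrt (dotp u u).

Definition diam (R : realType) (n : nat) (A : set 'rV[R]_n) : R :=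
  sup [set enorm (z.1 - z.2) | z in A `*` A].

Definition boundary (T : topologicalType) (A : set T) : set T :=
  closure A `\` interior A.

(* As a real-valued infimum this is 0 when A is empty; for A the boundary of a
   nonempty compact set of R^n this only happens when n = 0. *)
Definition dist (R : realType) (n : nat) (u : 'rV[R]_n) (A : set 'rV[R]_n) : R :=
  inf [set enorm (u - v) | v in A].

Definition argmin (R : realType) (T : Type) (A : set T) (F : T -> R) : set T :=
  [set z | A z /\ forall w, A w -> F z <= F w].

Definition argmax (R : realType) (T : Type) (A : set T) (F : T -> R) : set T :=
  [set z | A z /\ forall w, A w -> F w <= F z].

Definition concave_function (R : realType) (n : nat) (A : set 'rV[R]_n)
    (g : 'rV[R]_n -> R) : Prop :=
  convex_function A (fun z => - g z).

Definition strongly_convex (R : realType) (n : nat) (mu : R)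
    (A : set 'rV[R]_n) (g : 'rV[R]_n -> R) : Prop :=
  forall (u v : 'rV[R]_n) (l : R), A u -> A v -> 0 <= l <= 1 ->
    g (l *: u + (1 - l) *: v) <=
      l * g u + (1 - l) * g v - mu / 2 * l * (1 - l) * enorm (u - v) ^+ 2.

Definition strongly_concave (R : realType) (n : nat) (mu : R)
    (A : set 'rV[R]_n) (g : 'rV[R]_n -> R) : Prop :=
  strongly_convex mu A (fun z => - g z).

(* f is (Frechet) differentiable at (x, y) as a function on X * Y, with partial
   gradients a (in x) and b (in y).  Only values of f on X * Y are involved, so
   at boundary points this does not presuppose an extension of f outside X * Y;
   (a, b) is unique when X and Y are convex with nonempty interior. *)
Definition is_gradient (R : realType) (n m : nat)
    (X : set 'rV[R]_n) (Y : set 'rV[R]_m) (f : 'rV[R]_n -> 'rV[R]_m -> R)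
    (x : 'rV[R]_n) (y : 'rV[R]_m) (a : 'rV[R]_n) (b : 'rV[R]_m) : Prop :=
  forall e : R, 0 < e ->
    \forall z \near within (X `*` Y) (nbhs (x, y)),
      `|f z.1 z.2 - f x y - dotp a (z.1 - x) - dotp b (z.2 - y)|
        <= e * (enorm (z.1 - x) + enorm (z.2 - y)).

Definition nash_equilibrium (R : realType) (n m : nat)
    (X : set 'rV[R]_n) (Y : set 'rV[R]_m) (f : 'rV[R]_n -> 'rV[R]_m -> R)
    (xs : 'rV[R]_n) (ys : 'rV[R]_m) : Prop :=
  [/\ X xs, Y ys & forall x y, X x -> Y y ->
    f xs y <= f xs ys /\ f xs ys <= f x ys].

(* Main.v *)
From mathcomp Require Import ring lra.
Require Import Defs.

(* For a fixed game with equilibrium (x', y'), let h(x, y) = f(x, y') - f(x', y)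
   and let g be the Frank-Wolfe duality gap at (x, y).
   - The quadratic upper bound for f(., y') and - f(x', .) gives
     h+ <= h - eta g + eta (D_X L_xy |y - y'| + D_Y L_yx |x - x'|)
         + eta^2 C / 2;
     the coupling term comes from using the gradients at (x, y) instead of
     those at (x, y') and (x', y).
   - Since x' and y' lie at depth delta_X and delta_Y inside the sets, moving
     from them against the gradients stays feasible, so that
     g >= h + delta_X |grad_x f| + delta_Y |grad_y f|.  Strong convexity turns
     this into g >= m sqrt(2 h), m being the denominator in nu, and bounds the
     coupling term by (1 - nu) g.
   The step eta = nu g / C then yields
   h+ <= h - nu^2 g^2 / (2 C) <= beta_FW h.  Passing from f_t to f_(t+1) costs
   2 F^sup, and moving the equilibrium costs a linear term only, because the
   gradient vanishes at an interior equilibrium; this gives the recursion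
   h_(t+1) <= beta_FW h_t + err_(t+1).  The regret satisfies
   R_(T+1) = rho R_T + h_(T+1), and both recursions contract to 0. *)

Local Open Scope classical_set_scope.
Local Open Scope ring_scope.

(** * Euclidean inner product and norm *)

Lemma dotpC (R : realType) (n : nat) (u v : 'rV[R]_n) : dotp u v = dotp v u.
Proof. by apply: eq_bigr => i _; rewrite mulrC. Qed.

Lemma dotpDl (R : realType) (n : nat) (u v w : 'rV[R]_n) :
  dotp (u + v) w = dotp u w + dotp v w.
Proof. by rewrite -big_split; apply: eq_bigr => i _; rewrite mxE mulrDl. Qed.

Lemma dotpZl (R : realType) (n : nat) (k : R) (u v : 'rV[R]_n) :
  dotp (k *: u) v = k * dotp u v.
Proof. by rewrite mulr_sumr; apply: eq_bigr => i _; rewrite mxE mulrA. Qed.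

Lemma dotpNl (R : realType) (n : nat) (u v : 'rV[R]_n) :
  dotp (- u) v = - dotp u v.
Proof. by rewrite -scaleN1r dotpZl mulN1r. Qed.

Lemma dotpDr (R : realType) (n : nat) (u v w : 'rV[R]_n) :
  dotp w (u + v) = dotp w u + dotp w v.
Proof. by rewrite dotpC dotpDl !(dotpC _ w). Qed.

Lemma dotpZr (R : realType) (n : nat) (k : R) (u v : 'rV[R]_n) :
  dotp v (k *: u) = k * dotp v u.
Proof. by rewrite dotpC dotpZl dotpC. Qed.

Lemma dotpNr (R : realType) (n : nat) (u v : 'rV[R]_n) :
  dotp v (- u) = - dotp v u.
Proof. by rewrite dotpC dotpNl dotpC. Qed.

Definition dotpE := (dotpDl, dotpDr, dotpNl, dotpNr, dotpZl, dotpZr).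

Lemma dotp_ge0 (R : realType) (n : nat) (u : 'rV[R]_n) : 0 <= dotp u u.
Proof. by apply: sumr_ge0 => i _; rewrite -expr2 sqr_ge0. Qed.

Lemma dotp_eq0 (R : realType) (n : nat) (u : 'rV[R]_n) : dotp u u = 0 -> u = 0.
Proof.
move=> u0; apply/rowP => i; rewrite mxE; apply/eqP; rewrite -sqrf_eq0 expr2.
by move: u0 => /psumr_eq0P-> // j _; rewrite -expr2 sqr_ge0.
Qed.

Lemma enorm_ge0 (R : realType) (n : nat) (u : 'rV[R]_n) : 0 <= enorm u.
Proof. exact: sqrtr_ge0. Qed.

Lemma sqr_enorm (R : realType) (n : nat) (u : 'rV[R]_n) :
  enorm u ^+ 2 = dotp u u.
Proof. by rewrite sqr_sqrtr ?dotp_ge0. Qed.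

Lemma enorm_eq0 (R : realType) (n : nat) (u : 'rV[R]_n) : enorm u = 0 -> u = 0.
Proof. by move=> u0; apply: dotp_eq0; rewrite -sqr_enorm u0 expr0n. Qed.

Lemma enormZ (R : realType) (n : nat) (k : R) (u : 'rV[R]_n) :
  enorm (k *: u) = `|k| * enorm u.
Proof. by rewrite /enorm !dotpE mulrA -expr2 sqrtrM ?sqr_ge0// sqrtr_sqr. Qed.

Lemma enormN (R : realType) (n : nat) (u : 'rV[R]_n) : enorm (- u) = enorm u.
Proof. by rewrite -scaleN1r enormZ normrN1 mul1r. Qed.

Lemma enormB (R : realType) (n : nat) (u v : 'rV[R]_n) :
  enorm (u - v) = enorm (v - u).
Proof. by rewrite -enormN opprB. Qed.

(** Cauchy-Schwarz. The vector [dotp v v *: u - dotp u v *: v] is the component of [u] orthogonal to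
    [v], cleared of denominators. *)
Lemma dotp_le (R : realType) (n : nat) (u v : 'rV[R]_n) :
  dotp u v <= enorm u * enorm v.
Proof.
have [v0|v0] := eqVneq (dotp v v) 0.
  by rewrite (dotp_eq0 v0) -(scale0r u) dotpZr enormZ normr0 !mul0r mulr0.
have vv : 0 < dotp v v by rewrite lt0r v0 dotp_ge0.
have := dotp_ge0 (dotp v v *: u - dotp u v *: v).
rewrite !dotpE (dotpC v u) => h.
have {}h : 0 <= dotp v v * (dotp u u * dotp v v - dotp u v ^+ 2) by nra.
move: h; rewrite pmulr_rge0// subr_ge0 => h.
apply: le_trans (ler_norm _) _; rewrite -sqrtr_sqr -sqrtrM ?dotp_ge0//.
exact: ler_wsqrtr.
Qed.

(** * Segments, diameter and distance to the boundary *)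

Lemma convex_set_segment (R : realType) (n : nat) (A : set 'rV[R]_n)
    (u v : 'rV[R]_n) (l : R) :
  convex_set A -> A u -> A v -> 0 <= l <= 1 -> A ((1 - l) *: u + l *: v).
Proof.
move=> cA Au Av /andP[l0 l1].
have /(_ l0 l1) := cA v u (@Itv01 R l _ _).
by rewrite !inE => /(_ Av Au); rewrite /conv/= addrC.
Qed.

Lemma segmentE (R : realType) (n : nat) (u v : 'rV[R]_n) (l : R) :
  (1 - l) *: u + l *: v = u + l *: (v - u).
Proof. by rewrite scalerBl scale1r scalerBr addrAC addrA. Qed.

Lemma enorm_le_mx_norm (R : realType) (n : nat) (u : 'rV[R]_n) :
  enorm u <= Num.sqrt n%:R * `|u|.
Proof.
rewrite -[X in _ * X]ger0_norm// -sqrtr_sqr -sqrtrM ?ler0n// ler_wsqrtr//.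
rewrite -[n in n%:R]card_ord -mulr_natl mulr1 -sumr_const mulr_suml.
apply: ler_sum => i _; rewrite mul1r -expr2 -real_normK ?num_real//.
rewrite lerXn2r ?nnegrE//.
rewrite -[`|u|]/(mx_norm u) mx_normrE.
by apply: (le_bigmax _ (fun ij : 'I_1 * 'I_n => `|u ij.1 ij.2|) (0, i)).
Qed.

Lemma diam_ub (R : realType) (n : nat) (A : set 'rV[R]_n) (u v : 'rV[R]_n) :
  compact A -> A u -> A v -> enorm (u - v) <= diam A.
Proof.
move=> cA Au Av; apply: ub_le_sup; last by exists (u, v).
have [M [_ /(_ (M + 1))AM]] := compact_bounded cA.
exists (Num.sqrt n%:R * ((M + 1) + (M + 1))) => _ [[a b] [/= Aa Ab]] <-.
apply: le_trans (enorm_le_mx_norm _) _.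
rewrite ler_wpM2l ?sqrtr_ge0//; apply: le_trans (ler_normB _ _) _.
by rewrite lerD// AM ?ltrDl.
Qed.

Lemma dist_le (R : realType) (n : nat) (A : set 'rV[R]_n) (u v : 'rV[R]_n) :
  A v -> dist u A <= enorm (u - v).
Proof.
move=> Av; apply: ge_inf; last by exists v.
by exists 0 => _ [w _ <-]; exact: enorm_ge0.
Qed.

Lemma dist_ge0 (R : realType) (n : nat) (A : set 'rV[R]_n) (u : 'rV[R]_n) :
  0 <= dist u A.
Proof.
have [->|/set0P[v Av]] := eqVneq A set0; first by rewrite /dist image_set0 inf0.
apply: lb_le_inf; first by exists (enorm (u - v)), v.
by move=> _ [w _ <-]; exact: enorm_ge0.
Qed.

(** Let [q] be the largest parameter up to [r] at which the ray [u + s *: d] is in [A]. If [q < r],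
    that point is on the boundary, at distance [q * enorm d < r * enorm d] from [u], against the
    distance bound. *)
Lemma mem_of_dist_boundary (R : realType) (n : nat) (A : set 'rV[R]_n)
    (u d : 'rV[R]_n) (r : R) :
  closed A -> A u -> 0 <= r -> r * enorm d <= dist u (boundary A) ->
  0 < enorm d -> A (u + r *: d).
Proof.
move=> cA Au r0 rd d0.
have cont (s : R) : {for s, continuous (fun s : R => u + s *: d)}.
  apply: cvgD; first exact: cvg_cst.
  by apply: continuousZr_tmp; exact: cvg_id.
pose S := [set s : R | 0 <= s <= r /\ A (u + s *: d)].
have S0 : S 0 by split; [rewrite lexx r0 | rewrite scale0r addr0].
have Sr : ubound S r by move=> s [/andP[]].
have supS : has_sup S by split; [exists 0 | exists r].
set q := sup S.
have q0 : 0 <= q by apply: ub_le_sup => //; exists r.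
have qr : q <= r by apply: ge_sup => //; exists 0.
have Aq : A (u + q *: d).
  apply: contrapT => nA.
  have := cont q (~` A); rewrite /= => /(_ _)[].
    apply: open_nbhs_nbhs; split => //; exact: closed_openC.
  move=> e /= e0 he.
  have [s Ss qs] := sup_adherent e0 supS.
  have sq : s <= q by apply: ub_le_sup => //; exists r.
  have := he s; rewrite /= => h.
  case: Ss => _; apply: h; rewrite ger0_norm ?subr_ge0//.
  by rewrite ltrBlDr -ltrBlDl.
have [->//|qr'] := eqVneq r q.
have {qr'}qr : q < r by rewrite lt_neqAle eq_sym qr' qr.
have bq : boundary A (u + q *: d).
  split; first exact: subset_closure.
  move=> iA.
  have := cont q A iA => -[e /= e0 he].
  near (q^'+) => s.
  have qs : q < s by near: s; exact: nbhs_right_gt.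
  have Ss : S s.
    split; first by rewrite (le_trans q0 (ltW qs))/=; near: s; exact: nbhs_right_le.
    apply: (he s) => /=; rewrite distrC gtr0_norm ?subr_gt0//.
    by near: s; exact: nbhs_right_ltDr.
  have : s <= q by apply: ub_le_sup => //; exists r.
  by rewrite leNgt qs.
have := le_trans rd (dist_le u bq).
rewrite opprD addNKr enormN enormZ ger0_norm// ler_pM2r//.
by rewrite leNgt qr.
Unshelve. all: end_near.
Qed.

(** For [r] nonzero the point is [u - (delta / enorm r) *: r], the minimizer of [dotp r] on the ball
    of radius [delta] around [u]; the distance bound keeps it in [A]. *)
Lemma dotp_min_of_dist_boundary (R : realType) (n : nat) (A : set 'rV[R]_n)
    (u r : 'rV[R]_n) (delta : R) :
  closed A -> A u -> 0 <= delta -> delta <= dist u (boundary A) ->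
  exists2 p, A p & dotp r p = dotp r u - delta * enorm r.
Proof.
move=> cA Au d0 dd.
have [r0|r0] := eqVneq (enorm r) 0.
  by exists u => //; rewrite r0 mulr0 subr0.
have rp : 0 < enorm r by rewrite lt0r r0 enorm_ge0.
exists (u + (delta / enorm r) *: (- r)).
  apply: mem_of_dist_boundary => //; rewrite ?enormN// ?divr_ge0 ?enorm_ge0//.
  by rewrite divfK.
rewrite !dotpE -sqr_enorm; field; exact: r0.
Qed.

(** * Gradients along segments *)

(* One-sided derivatives along segments of [A] suffice for all the convexity
   estimates, and spare a separate treatment of boundary points. *)
Definition directional_gradient (R : realType) (n : nat) (A : set 'rV[R]_n)
    (phi : 'rV[R]_n -> R) (u a : 'rV[R]_n) : Prop :=
  forall v e, A v -> 0 < e ->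
    \forall l \near (0 : R)^'+,
      `|phi (u + l *: (v - u)) - phi u - l * dotp a (v - u)| <= e * l.

Lemma near_segment (R : realType) (n : nat) (u d : 'rV[R]_n) :
  u + l *: d @[l --> (0 : R)^'+] --> u.
Proof.
rewrite -[X in _ --> X]addr0 -[X in _ + X](scale0r d).
apply: cvg_at_right_filter; apply: cvgD; first exact: cvg_cst.
by apply: continuousZr_tmp; exact: cvg_id.
Qed.

Lemma is_gradient_segment (R : realType) (n m : nat) (X : set 'rV[R]_n)
    (Y : set 'rV[R]_m) (f : 'rV[R]_n -> 'rV[R]_m -> R) u v a b u' v' (e : R) :
  convex_set X -> convex_set Y -> X u -> Y v -> X u' -> Y v' -> 0 < e ->
  is_gradient X Y f u v a b ->
  \forall l \near (0 : R)^'+,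
    `|f (u + l *: (u' - u)) (v + l *: (v' - v)) - f u v
      - l * dotp a (u' - u) - l * dotp b (v' - v)| <= e * l.
Proof.
move=> cX cY Xu Yv Xu' Yv' e0 fab.
(* The summand 1 keeps [k] positive when both displacements vanish, so that [e / k] is an admissible
   precision. *)
pose k := enorm (u' - u) + enorm (v' - v) + 1.
have k0 : 0 < k by rewrite ltr_wpDl// addr_ge0 ?enorm_ge0.
have cv : (u + l *: (u' - u), v + l *: (v' - v)) @[l --> (0 : R)^'+] --> (u, v).
  exact: (cvg_pair (@near_segment _ _ u (u' - u)) (@near_segment _ _ v (v' - v))).
have := cv _ (fab (e / k) (divr_gt0 e0 k0)).
rewrite /= => H; near=> l.
have l0 : 0 < l by near: l; exact: nbhs_right_gt.
have l1 : l <= 1 by near: l; exact: nbhs_right_le.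
have l01 : 0 <= l <= 1 by rewrite ltW.
have : (X `*` Y) (u + l *: (u' - u), v + l *: (v' - v)).
  by split; rewrite /= -segmentE; exact: convex_set_segment.
have hl : (X `*` Y) (u + l *: (u' - u), v + l *: (v' - v)) ->
    `|f (u + l *: (u' - u)) (v + l *: (v' - v)) - f u v
     - dotp a (u + l *: (u' - u) - u) - dotp b (v + l *: (v' - v) - v)|
     <= e / k * (enorm (u + l *: (u' - u) - u) + enorm (v + l *: (v' - v) - v)).
  by near: l; exact: H.
move=> /hl.
rewrite ![_ + _ *: _ - _]addrAC !subrr !add0r !dotpZr !enormZ (gtr0_norm l0).
move=> /le_trans; apply; rewrite -mulrDr mulrCA mulrC ler_pM2r//.
by rewrite mulrAC ler_pdivrMr// ler_pM2l// lerDl.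
Unshelve. all: end_near.
Qed.

Lemma is_gradient_left (R : realType) (n m : nat) (X : set 'rV[R]_n)
    (Y : set 'rV[R]_m) (f : 'rV[R]_n -> 'rV[R]_m -> R) u v a b :
  convex_set X -> convex_set Y -> X u -> Y v -> is_gradient X Y f u v a b ->
  directional_gradient X (fun z => f z v) u a.
Proof.
move=> cX cY Xu Yv fab u' e Xu' e0.
have := is_gradient_segment cX cY Xu Yv Xu' Yv e0 fab.
apply: filterS => l; rewrite subrr scaler0 addr0.
by rewrite -[X in _ - _ * dotp b X](scale0r 0) dotpZr mul0r mulr0 subr0.
Qed.

Lemma is_gradient_right (R : realType) (n m : nat) (X : set 'rV[R]_n)
    (Y : set 'rV[R]_m) (f : 'rV[R]_n -> 'rV[R]_m -> R) u v a b :
  convex_set X -> convex_set Y -> X u -> Y v -> is_gradient X Y f u v a b ->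
  directional_gradient Y (fun z => - f u z) v (- b).
Proof.
move=> cX cY Xu Yv fab v' e Yv' e0.
have := is_gradient_segment cX cY Xu Yv Xu Yv' e0 fab.
apply: filterS => l; rewrite subrr scaler0 addr0.
rewrite -[X in _ - _ * dotp a X](scale0r 0) dotpZr mul0r mulr0 subr0.
by rewrite -normrN dotpNl mulrN !opprD !opprK.
Qed.

(** * First-order estimates for strongly convex functions *)

(** Divide the strong convexity inequality at [u + l *: (v - u)] by [l] and let [l] tend to 0. *)
Lemma strongly_convex_gradient (R : realType) (n : nat) (A : set 'rV[R]_n)
    (phi : 'rV[R]_n -> R) (u v a : 'rV[R]_n) (mu : R) :
  0 <= mu -> strongly_convex mu A phi -> directional_gradient A phi u a ->
  A u -> A v ->
  phi u + dotp a (v - u) + mu / 2 * enorm (v - u) ^+ 2 <= phi v.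
Proof.
move=> mu0 sc ga Au Av; apply/ler_addgt0Pr => e e0.
have e2 : 0 < e / 2 by rewrite divr_gt0.
set D := enorm (v - u) ^+ 2.
have D0 : 0 <= D by exact: sqr_ge0.
have k0 : 0 < mu * D + 1 by rewrite ltr_wpDl// mulr_ge0.
near (0 : R)^'+ => l.
have l0 : 0 < l by near: l; exact: nbhs_right_gt.
have l1 : l <= 1 by near: l; exact: nbhs_right_le.
(* This gives [mu * D * l <= e]: the factor [1 - l] of the quadratic term costs at most [e / 2], and
   the differentiability error takes the other half. *)
have le : l <= e / (mu * D + 1).
  by near: l; apply: nbhs_right_le; rewrite divr_gt0.
have : `|phi (u + l *: (v - u)) - phi u - l * dotp a (v - u)| <= e / 2 * l.
  by near: l; exact: ga.
rewrite ler_norml => /andP[H _].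
have := sc v u l Av Au; rewrite ltW//= => /(_ l1).
rewrite addrC segmentE -/D.
move: le; rewrite ler_pdivlMr// => le.
move=> H2; rewrite -(ler_pM2l l0).
have : l * (mu * D * l) <= l * e.
  by rewrite ler_pM2l//; nra.
nra.
Unshelve. all: end_near.
Qed.

Lemma minimizer_gradient (R : realType) (n : nat) (A : set 'rV[R]_n)
    (phi : 'rV[R]_n -> R) (u v a : 'rV[R]_n) :
  convex_set A -> directional_gradient A phi u a -> A u -> A v ->
  (forall w, A w -> phi u <= phi w) -> 0 <= dotp a (v - u).
Proof.
move=> cA ga Au Av umin; apply/ler_addgt0Pr => e e0.
near (0 : R)^'+ => l.
have l0 : 0 < l by near: l; exact: nbhs_right_gt.
have l1 : l <= 1 by near: l; exact: nbhs_right_le.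
have : `|phi (u + l *: (v - u)) - phi u - l * dotp a (v - u)| <= e * l.
  by near: l; exact: ga.
rewrite ler_norml => /andP[_ H].
have : phi u <= phi (u + l *: (v - u)).
  by apply: umin; rewrite -segmentE; apply: convex_set_segment; rewrite ?l1 ?ltW.
by move=> H2; rewrite -(ler_pM2l l0); lra.
Unshelve. all: end_near.
Qed.

(** Test the variational inequality at the point reached from [u] by moving against [a]: it reads
    [- d * enorm a >= 0], with [d] the positive distance to the boundary. *)
Lemma minimizer_gradient_eq0 (R : realType) (n : nat) (A : set 'rV[R]_n)
    (phi : 'rV[R]_n -> R) (u a : 'rV[R]_n) :
  convex_set A -> closed A -> directional_gradient A phi u a -> A u ->
  (forall w, A w -> phi u <= phi w) -> 0 < dist u (boundary A) -> a = 0.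
Proof.
move=> cA clA ga Au umin d0.
have [p Ap ap] := dotp_min_of_dist_boundary a clA Au (ltW d0) (lexx _).
have := minimizer_gradient cA ga Au Ap umin.
rewrite dotpDr dotpNr ap addrAC subrr add0r oppr_ge0 pmulr_rle0// => a0.
by apply: enorm_eq0; apply/eqP; rewrite eq_le a0 enorm_ge0.
Qed.

(* Convexity bounds [phi v - phi u] by the gradient at [v], which gives the
   constant [L] instead of [L / 2]; going through the midpoint turns a valid
   constant [K] into [L / 4 + K / 2], and iterating reaches [L / 2]. *)
Lemma descent (R : realType) (n : nat) (A : set 'rV[R]_n)
    (phi : 'rV[R]_n -> R) (G : 'rV[R]_n -> 'rV[R]_n) (mu L : R) :
  convex_set A -> 0 <= mu -> strongly_convex mu A phi ->
  (forall u, A u -> directional_gradient A phi u (G u)) ->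
  (forall u v, A u -> A v -> enorm (G u - G v) <= L * enorm (u - v)) ->
  forall u v, A u -> A v ->
  phi v <= phi u + dotp (G u) (v - u) + L / 2 * enorm (v - u) ^+ 2.
Proof.
move=> cA mu0 sc gG LG.
have dotG u v w (k : R) : A u -> A v -> 0 <= k -> w = k *: (v - u) ->
    dotp (G v) w <= dotp (G u) w + k * (L * enorm (v - u) ^+ 2).
  move=> Au Av k0 ->; rewrite !dotpZr -mulrDr ler_wpM2l// -lerBlDl.
  rewrite -dotpNl -dotpDl (le_trans (dotp_le _ _))// expr2 mulrA.
  by rewrite ler_wpM2r ?enorm_ge0// LG.
(* These are the iterates of [K -> L / 4 + K / 2] started from [K = L] at [N = 0]. *)
have H (N : nat) u v : A u -> A v -> phi v <=
    phi u + dotp (G u) (v - u) + (L / 2 + L / 2 / 2 ^+ N) * enorm (v - u) ^+ 2.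
  elim: N u v => [|N IH] u v Au Av.
    have := strongly_convex_gradient mu0 sc (gG v Av) Av Au.
    have -> : dotp (G v) (u - v) = - dotp (G v) (v - u) by rewrite -dotpNr opprB.
    have := dotG u v (v - u) 1 Au Av ler01; rewrite scale1r mul1r => /(_ erefl).
    have : 0 <= mu / 2 * enorm (u - v) ^+ 2.
      by rewrite mulr_ge0 ?sqr_ge0 ?divr_ge0.
    rewrite expr0 divr1 -splitr; lra.
  pose w := u + 2^-1 *: (v - u).
  have Aw : A w.
    rewrite /w -segmentE; apply: convex_set_segment => //.
    by rewrite invr_ge0 ler0n invf_le1 ?ler1n.
  have wu : w - u = 2^-1 *: (v - u) by rewrite /w addrAC subrr add0r.
  have vw : v - w = 2^-1 *: (v - u).
    rewrite /w opprD addrA -[X in X - _]scale1r -scalerBl.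
    by congr (_ *: _); lra.
  have h1 := IH u w Au Aw; have h2 := IH w v Aw Av.
  have h3 := dotG u w (v - w) 1 Au Aw ler01.
  move: h1 h2 h3; rewrite vw wu scale1r => h1 h2 /(_ erefl) h3.
  move: h1 h2 h3.
  rewrite !dotpZr !enormZ ger0_norm ?invr_ge0// !exprMn [2 ^+ N.+1]exprS invfM.
  set D := enorm _ ^+ 2; set i := (2 ^+ N)^-1.
  lra.
move=> u v Au Av.
set D := enorm (v - u) ^+ 2.
have D0 : 0 <= D by exact: sqr_ge0.
have cv : phi u + dotp (G u) (v - u) + (L / 2 + L / 2 / 2 ^+ N) * D
    @[N --> \oo] --> phi u + dotp (G u) (v - u) + L / 2 * D.
  apply: cvgD; first exact: cvg_cst.
  apply: cvgMr_tmp; rewrite -[X in _ --> X]addr0; apply: cvgD; first exact: cvg_cst.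
  rewrite -[X in _ --> X](mulr0 (L / 2)); apply: cvgMl_tmp.
  under eq_fun do rewrite -exprVn.
  by apply: cvg_expr; rewrite gtr0_norm ?invf_lt1 ?ltr1n.
by apply: (cvgr_to_ge cv); near=> N; exact: H.
Unshelve. all: end_near.
Qed.

(** [r] is the gradient that the algorithm sees instead of [G u]; by Cauchy-Schwarz the mismatch [k]
    adds at most [eta * (D * k)] to the bound of [descent]. *)
Lemma frank_wolfe_step (R : realType) (n : nat) (A : set 'rV[R]_n)
    (phi : 'rV[R]_n -> R) (G : 'rV[R]_n -> 'rV[R]_n) (mu L eta k D : R)
    (u s r : 'rV[R]_n) :
  convex_set A -> 0 <= mu -> strongly_convex mu A phi ->
  (forall u, A u -> directional_gradient A phi u (G u)) ->
  (forall u v, A u -> A v -> enorm (G u - G v) <= L * enorm (u - v)) ->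
  A u -> A s -> 0 <= eta <= 1 -> 0 <= L -> enorm (s - u) <= D ->
  enorm (G u - r) <= k ->
  phi ((1 - eta) *: u + eta *: s) <=
    phi u - eta * dotp r (u - s) + eta * (D * k) + eta ^+ 2 * (L / 2 * D ^+ 2).
Proof.
move=> cA mu0 sc gG LG Au As eta01 L0 sD Gk.
have Aw : A ((1 - eta) *: u + eta *: s) by exact: convex_set_segment.
apply: le_trans (descent cA mu0 sc gG LG Au Aw) _.
rewrite segmentE (addrAC u) subrr add0r dotpZr enormZ exprMn real_normK ?num_real//.
have /andP[eta0 _] := eta01.
have D2 : enorm (s - u) ^+ 2 <= D ^+ 2.
  by rewrite lerXn2r ?nnegrE ?(le_trans _ sD) ?enorm_ge0.
rewrite -(addrA (_ - _)) -(addrA (phi u)) -!addrA lerD2l addrA lerD//; last first.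
  rewrite mulrCA ler_wpM2l ?sqr_ge0// ler_wpM2l// divr_ge0//.
rewrite -mulrN -mulrDr ler_wpM2l// -dotpNr opprB -lerBlDl -dotpNl -dotpDl.
rewrite (le_trans (dotp_le _ _))// mulrC ler_pM ?enorm_ge0//.
Qed.

(** * Estimates for a single player *)

(* One player's share of the game: [phi u v] is the cost of playing [u] against
   [v].  The minimizer has [phi = f]; the maximizer has [phi = - f] with the
   variables exchanged. *)
Record smooth_player (R : realType) (n m : nat) (X : set 'rV[R]_n)
    (Y : set 'rV[R]_m) (phi : 'rV[R]_n -> 'rV[R]_m -> R)
    (G : 'rV[R]_n -> 'rV[R]_m -> 'rV[R]_n) (mu L K : R) : Prop := SmoothPlayer {
  player_compact : compact X;
  player_convex : convex_set X;
  player_mu_gt0 : 0 < mu;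
  player_L_ge0 : 0 <= L;
  player_K_ge0 : 0 <= K;
  player_opponent_compact : compact Y;
  player_strongly_convex :
    forall v, Y v -> strongly_convex mu X (fun u => phi u v);
  player_gradient : forall u v, X u -> Y v ->
    directional_gradient X (fun z => phi z v) u (G u v);
  player_lipschitz : forall u u' v, X u -> X u' -> Y v ->
    enorm (G u v - G u' v) <= L * enorm (u - u');
  player_lipschitz_opponent : forall u v v', X u -> Y v -> Y v' ->
    enorm (G u v - G u v') <= K * enorm (v - v') }.

Lemma player_gap_ge0 (R : realType) (n : nat) (X : set 'rV[R]_n)
    (r u s : 'rV[R]_n) : X u -> argmin X (dotp r) s -> 0 <= dotp r (u - s).
Proof. by move=> Xu [_ /(_ u Xu)]; rewrite dotpDr dotpNr subr_ge0. Qed.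

Lemma player_gradient_ub (R : realType) (n m : nat) (X : set 'rV[R]_n)
    (Y : set 'rV[R]_m) phi G (mu L K : R) u us v :
  smooth_player X Y phi G mu L K -> X u -> X us -> Y v ->
  phi u v - phi us v + mu / 2 * enorm (u - us) ^+ 2 <= dotp (G u v) (u - us).
Proof.
move=> P Xu Xus Yv.
have := strongly_convex_gradient (ltW (player_mu_gt0 P))
  (player_strongly_convex P Yv) (player_gradient P Xu Yv) Xu Xus.
have -> : dotp (G u v) (us - u) = - dotp (G u v) (u - us).
  by rewrite -dotpNr opprB.
rewrite (enormB us); lra.
Qed.

Lemma player_interior_gap (R : realType) (n : nat) (X : set 'rV[R]_n)
    (r u us s : 'rV[R]_n) (delta : R) :
  compact X -> X us -> 0 <= delta -> delta <= dist us (boundary X) ->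
  argmin X (dotp r) s -> dotp r (u - us) + delta * enorm r <= dotp r (u - s).
Proof.
move=> cX Xus d0 dd [_ smin].
have clX : closed X by apply: compact_closed => //; exact: norm_hausdorff.
have [p Xp rp] := dotp_min_of_dist_boundary r clX Xus d0 dd.
have := smin p Xp; rewrite rp !dotpDr !dotpNr; lra.
Qed.

Section Equilibrium.
Context (R : realType) (n m : nat) (X : set 'rV[R]_n) (Y : set 'rV[R]_m).
Context (phi : 'rV[R]_n -> 'rV[R]_m -> R).
Context (G : 'rV[R]_n -> 'rV[R]_m -> 'rV[R]_n) (mu L K : R).
Context (us : 'rV[R]_n) (vs : 'rV[R]_m).
Hypothesis P : smooth_player X Y phi G mu L K.
Hypotheses (Xus : X us) (Yvs : Y vs).
Hypothesis us_min : forall u, X u -> phi us vs <= phi u vs.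

Lemma player_growth u : X u ->
  phi us vs + mu / 2 * enorm (u - us) ^+ 2 <= phi u vs.
Proof.
move=> Xu.
have := strongly_convex_gradient (ltW (player_mu_gt0 P))
  (player_strongly_convex P Yvs) (player_gradient P Xus Yvs) Xus Xu.
have := minimizer_gradient (player_convex P) (player_gradient P Xus Yvs)
  Xus Xu us_min.
lra.
Qed.

Lemma player_step u v s eta : X u -> Y v -> X s -> 0 <= eta <= 1 ->
  phi ((1 - eta) *: u + eta *: s) vs <=
    phi u vs - eta * dotp (G u v) (u - s)
    + eta * (diam X * (K * enorm (v - vs))) + eta ^+ 2 * (L / 2 * diam X ^+ 2).
Proof.
move=> Xu Yv Xs eta01.
apply: (frank_wolfe_step (G := fun z => G z vs) (player_convex P) (ltW (player_mu_gt0 P))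
  (player_strongly_convex P Yvs)) => //.
- by move=> w Xw; exact: (player_gradient P).
- by move=> w w' Xw Xw'; exact: (player_lipschitz P).
- exact: (player_L_ge0 P).
- exact: (diam_ub (player_compact P)).
- by rewrite (enormB v); exact: (player_lipschitz_opponent P).
Qed.

Hypothesis us_int : 0 < dist us (boundary X).

Lemma player_gradient_eq0 : G us vs = 0.
Proof.
apply: minimizer_gradient_eq0 (player_convex P) _ (player_gradient P Xus Yvs)
  Xus us_min us_int.
by apply: compact_closed (player_compact P); exact: norm_hausdorff.
Qed.

Lemma player_enorm_gradient v : Y v -> enorm (G us v) <= K * enorm (v - vs).
Proof.
move=> Yv; rewrite -[G us v]subr0 -player_gradient_eq0.
exact: (player_lipschitz_opponent P).
Qed.

(** Split [G u v] as [(G u v - G us v) + G us v]; the second term is at most [K * diam Y] in norm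
    because [G us] vanishes at [vs]. Added over both players, these bounds give exactly [C]. *)
Lemma player_gap_ub u v s : X u -> Y v -> X s ->
  dotp (G u v) (u - s) <= (L * diam X + K * diam Y) * diam X.
Proof.
move=> Xu Yv Xs.
have cX := player_compact P; have cY := player_opponent_compact P.
have DX0 : 0 <= diam X by rewrite (le_trans (enorm_ge0 _) (diam_ub cX Xu Xs)).
rewrite -[G u v](subrK (G us v)) dotpDl mulrDl.
apply: lerD; apply: le_trans (dotp_le _ _) _;
  apply: ler_pM; rewrite ?enorm_ge0//.
- apply: le_trans (player_lipschitz P Xu Xus Yv) _.
  by rewrite ler_wpM2l ?(player_L_ge0 P)// diam_ub.
- exact: diam_ub.
- apply: le_trans (player_enorm_gradient Yv) _.
  by rewrite ler_wpM2l ?(player_K_ge0 P)// diam_ub.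
- exact: diam_ub.
Qed.

(** Convexity at [us] bounds the difference by means of [G us v], which is small since
    [G us vs = 0]. Applied with [us] the old and [u] the new equilibrium strategy. *)
Lemma player_drift u v : X u -> Y v ->
  phi us v - phi u v <= diam Y * K * enorm (u - us).
Proof.
move=> Xu Yv; have cY := player_opponent_compact P.
have := strongly_convex_gradient (ltW (player_mu_gt0 P))
  (player_strongly_convex P Yv) (player_gradient P Xus Yv) Xus Xu.
have : 0 <= mu / 2 * enorm (u - us) ^+ 2.
  by rewrite mulr_ge0 ?sqr_ge0// divr_ge0// ltW// (player_mu_gt0 P).
have : dotp (- G us v) (u - us) <= diam Y * K * enorm (u - us).
  apply: le_trans (dotp_le _ _) _; rewrite enormN ler_wpM2r ?enorm_ge0//.
  apply: le_trans (player_enorm_gradient Yv) _.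
  by rewrite mulrC ler_wpM2r ?(player_K_ge0 P)// diam_ub.
rewrite dotpNl; lra.
Qed.

End Equilibrium.

(** * Arithmetic of one contraction step *)

(* Here [p] and [q] stand for the square roots of [mu_x] and [mu_y], [a], [b] for
   the distances to the equilibrium and [u], [v] for the gradient norms. *)
Lemma gap_contraction (R : realType) (p q dX dY kX kY m M a b u v h h' P g C : R) :
  0 < p -> 0 < q -> 0 < m -> m <= q * dY -> m <= p * dX ->
  0 <= M -> kX <= M * q -> kY <= M * p -> 0 < C ->
  0 <= a -> 0 <= b -> 0 <= u -> 0 <= v ->
  (p ^+ 2 * a ^+ 2 + q ^+ 2 * b ^+ 2) / 2 <= h ->
  h + (p ^+ 2 * a ^+ 2 + q ^+ 2 * b ^+ 2) / 2 <= P ->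
  P <= u * a + v * b -> P + (dX * u + dY * v) <= g ->
  let nu := 1 - Num.sqrt 2 * M / m in
  let eta := nu * g / C in
  0 < nu ->
  h' <= h - eta * g + eta * (kX * b + kY * a) + eta ^+ 2 * (C / 2) ->
  h' <= (1 - m ^+ 2 * nu ^+ 2 / C) * h.
Proof.
move=> p0 q0 m0 mY mX M0 kXM kYM C0 a0 b0 u0 v0 Hgrow Hlin HCS Hint nu eta nu0 Hstep.
have S0 : 0 <= p ^+ 2 * a ^+ 2 + q ^+ 2 * b ^+ 2.
  by rewrite addr_ge0// mulr_ge0// sqr_ge0.
have h0 : 0 <= h by apply: le_trans Hgrow; rewrite divr_ge0.
(* This rescaling absorbs the strong convexity constants: [h], the gap and the coupling term are all
   compared with [w = u' + v']. *)
pose u' := u / p; pose v' := v / q.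
have u'0 : 0 <= u' by rewrite divr_ge0// ltW.
have v'0 : 0 <= v' by rewrite divr_ge0// ltW.
have uE : u = u' * p by rewrite divfK// gt_eqF.
have vE : v = v' * q by rewrite divfK// gt_eqF.
pose w := u' + v'.
have w0 : 0 <= w by rewrite addr_ge0.
have hw : 2 * h <= w ^+ 2.
  (* [u'^2 + v'^2 >= 2 (u' p a + v' q b) - (p a)^2 - (q b)^2 >= 2 h] *)
  have := sqr_ge0 (u' - p * a); have := sqr_ge0 (v' - q * b).
  have := mulr_ge0 u'0 v'0; rewrite /w; move: HCS; rewrite uE vE; nra.
have mw : m * w <= g.
  apply: le_trans Hint; apply: ler_wpDl; first lra.
  rewrite uE vE /w mulrDr; apply: lerD.
    by have := ler_wpM2r u'0 mX; lra.
  by have := ler_wpM2r v'0 mY; lra.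
(* Origin of the factor [Num.sqrt 2] in [nu]: the square of the left side is at most twice the sum
   of squares, which [Hgrow] and [hw] bound by [w ^+ 2]. *)
have sw : p * a + q * b <= Num.sqrt 2 * w.
  rewrite -[w]ger0_norm// -sqrtr_sqr -sqrtrM ?ler0n//.
  apply: le_trans (ler_norm _) _; rewrite -sqrtr_sqr ler_wsqrtr//.
  have := sqr_ge0 (p * a - q * b); nra.
have g0 : 0 <= g by apply: le_trans mw; rewrite mulr_ge0// ltW.
have coupling : kX * b + kY * a <= (1 - nu) * g.
  apply: (@le_trans _ _ (M * (p * a + q * b))).
    have := ler_wpM2r b0 kXM; have := ler_wpM2r a0 kYM; lra.
  apply: le_trans (ler_wpM2l M0 sw) _.
  have -> : (1 - nu) * g = M * (Num.sqrt 2 * (g / m)) by rewrite /nu; ring.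
  by rewrite !ler_wpM2l ?sqrtr_ge0// ler_pdivlMr// mulrC.
have eta0 : 0 <= eta by rewrite divr_ge0 ?mulr_ge0// ltW.
have etaC : eta * C = nu * g by rewrite divfK// gt_eqF.
(* After the coupling bound the increment is at most [- eta * nu * g + eta ^+ 2 * C / 2], which
   [eta = nu * g / C] minimizes. *)
have {}Hstep : h' <= h - eta * (nu * g) / 2.
  have := ler_wpM2l eta0 coupling.
  have : eta ^+ 2 * (C / 2) = eta * (eta * C) / 2 by ring.
  rewrite etaC; lra.
apply: le_trans Hstep _.
have mwg : (m * w) ^+ 2 <= g ^+ 2 by rewrite lerXn2r ?nnegrE// mulr_ge0// ltW.
have hg : m ^+ 2 * (2 * h) <= g ^+ 2.
  by apply: le_trans mwg; rewrite exprMn ler_wpM2l// sqr_ge0.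
have -> : eta * (nu * g) / 2 = (nu ^+ 2 / C) * (g ^+ 2 / 2).
  by rewrite /eta; field; rewrite gt_eqF.
have c0 : 0 <= nu ^+ 2 / C by rewrite divr_ge0 ?sqr_ge0// ltW.
rewrite mulrBl mul1r lerD2l lerN2.
have -> : m ^+ 2 * nu ^+ 2 / C * h = nu ^+ 2 / C * (m ^+ 2 * h) by ring.
by rewrite ler_wpM2l//; lra.
Qed.

(** * Suprema, discounted sums and affine recursions *)

Lemma ler_sup_dist (R : realType) (T : topologicalType) (A : set T)
    (f g : T -> R) (z : T) :
  compact A -> {within A, continuous f} -> {within A, continuous g} -> A z ->
  `|f z - g z| <= sup [set `|f w - g w| | w in A].
Proof.
move=> cA cf cg Az; apply: ub_le_sup; last by exists z.
have [M [_ /(_ (M + 1))fM]] := compact_bounded (continuous_compact cf cA).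
have [N [_ /(_ (N + 1))gN]] := compact_bounded (continuous_compact cg cA).
exists ((M + 1) + (N + 1)) => _ [w Aw <-].
apply: le_trans (ler_normB _ _) _; apply: lerD.
  by apply: fM; [rewrite ltrDl|exists w].
by apply: gN; [rewrite ltrDl|exists w].
Qed.

Lemma discounted_sumS (R : realType) (q : R) (e : nat -> R) n :
  \sum_(1 <= i < n.+2) q ^+ (n.+1 - i) * e i =
  q * (\sum_(1 <= i < n.+1) q ^+ (n - i) * e i) + e n.+1.
Proof.
rewrite big_nat_recr//= subnn expr0 mul1r mulr_sumr; congr (_ + _).
apply: eq_big_nat => i /andP[_ ilt].
by rewrite subSn -1?ltnS// exprS mulrA.
Qed.

(** A discrete Gronwall inequality. *)
Lemma affine_recursion_le (R : realType) (q : R) (a e : nat -> R) :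
  0 <= q -> (forall n, a n.+1 <= q * a n + e n.+1) ->
  forall n, a n <= q ^+ n * a 0%N + \sum_(1 <= i < n.+1) q ^+ (n - i) * e i.
Proof.
move=> q0 ae; elim=> [|n IH]; first by rewrite big_geq// addr0 mul1r.
rewrite discounted_sumS exprS addrA -mulrA -mulrDr.
by apply: le_trans (ae n) _; rewrite lerD2r ler_wpM2l.
Qed.

(** Once the inputs stay below [(1 - q) * (eps / 2)], the recursion keeps the level [eps / 2], and
    any excess over it decays geometrically. *)
Lemma affine_recursion_cvg0 (R : realType) (q : R) (a e : nat -> R) :
  0 <= q < 1 -> (forall n, 0 <= a n) ->
  (forall n, a n.+1 <= q * a n + e n.+1) ->
  e @ \oo --> (0 : R) -> a @ \oo --> (0 : R).
Proof.
move=> /andP[q0 q1] a0 ae e0; apply/cvgr0Pnorm_le => eps eps0.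
have eps2 : 0 < eps / 2 by rewrite divr_gt0.
have [N _ eN] : \forall n \near \oo, `|e n| <= (1 - q) * (eps / 2).
  by move/cvgr0Pnorm_le : e0; apply; rewrite mulr_gt0 ?subr_gt0.
have H k : a (N + k)%N <= eps / 2 + q ^+ k * a N.
  elim: k => [|k IH]; first by rewrite addn0 mul1r lerDr ltW.
  rewrite addnS exprS -mulrA.
  have := ae (N + k)%N.
  have := le_trans (ler_norm _) (eN (N + k).+1 (leq_trans (leq_addr k N) (leqnSn _))).
  by have := ler_wpM2l q0 IH; lra.
have q_cvg : q ^+ k * a N @[k --> \oo] --> 0.
  rewrite -[X in _ --> X](mul0r (a N)); apply: cvgMr_tmp.
  by apply: cvg_expr; rewrite ger0_norm.
have [K _ qK] : \forall k \near \oo, `|q ^+ k * a N| <= eps / 2.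
  by move/cvgr0Pnorm_le : q_cvg; apply.
exists (N + K)%N => // n /= nNK.
have [Nn Kn] : (N <= n)%N /\ (K <= n - N)%N.
  have Nn := leq_trans (leq_addr _ _) nNK.
  by split=> //; rewrite leq_subRL.
have := H (n - N)%N; have := le_trans (ler_norm _) (qK _ Kn).
by rewrite subnKC// ger0_norm//; lra.
Qed.

Lemma sum_triangle_exchange (R : realType) (F : nat -> nat -> R) (T : nat) :
  \sum_(1 <= t < T.+1) \sum_(1 <= i < t.+1) F i t =
  \sum_(1 <= i < T.+1) \sum_(i <= t < T.+1) F i t.
Proof.
under eq_big_nat => t /andP[_ tT] do rewrite (big_nat_widen _ _ T.+1)//.
rewrite (exchange_big_dep_nat xpredT)//=; apply: eq_big_nat => i /andP[i1 _].
by rewrite [RHS](big_nat_widenl _ 1).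
Qed.

(** A positive distance rules out an empty boundary, whose distance is 0 by convention; a boundary
    point of the closed set [A] belongs to [A]. Positivity of the diameters follows from this. *)
Lemma dist_boundary_le_diam (R : realType) (n : nat) (A : set 'rV[R]_n)
    (u : 'rV[R]_n) :
  compact A -> A u -> 0 < dist u (boundary A) -> dist u (boundary A) <= diam A.
Proof.
move=> cA Au d0.
have [v bv] : boundary A !=set0.
  apply/set0P/negP => /eqP A0; move: d0.
  by rewrite /dist A0 image_set0 inf0 ltxx.
have clA : closed A by apply: compact_closed cA; exact: norm_hausdorff.
apply: le_trans (dist_le u bv) _; apply: diam_ub => //.
by case: bv; rewrite -(closure_id A).1.
Qed.

(** * Both players together: step size and contraction in one game *)

Section Game.
Context (R : realType) (n m : nat) (X : set 'rV[R]_n) (Y : set 'rV[R]_m).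
Context (f : 'rV[R]_n -> 'rV[R]_m -> R).
Context (gradx : 'rV[R]_n -> 'rV[R]_m -> 'rV[R]_n).
Context (grady : 'rV[R]_n -> 'rV[R]_m -> 'rV[R]_m).
Context (mux muy Lx Ly Lxy Lyx dX dY : R).
Context (xs x sx : 'rV[R]_n) (ys y sy : 'rV[R]_m).
Hypothesis PX : smooth_player X Y f gradx mux Lx Lxy.
Hypothesis PY : smooth_player Y X (fun v u => - f u v) (fun v u => - grady u v)
  muy Ly Lyx.
Hypothesis NE : nash_equilibrium X Y f xs ys.
Hypotheses (dX0 : 0 < dX) (dY0 : 0 < dY).
Hypothesis dXs : dX <= dist xs (boundary X).
Hypothesis dYs : dY <= dist ys (boundary Y).
Hypotheses (Xx : X x) (Yy : Y y).
Hypothesis sxP : argmin X (dotp (gradx x y)) sx.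
Hypothesis syP : argmax Y (dotp (grady x y)) sy.

Let DX := diam X.
Let DY := diam Y.
Let C := Lx * DX ^+ 2 + Ly * DY ^+ 2 + (Lxy + Lyx) * DX * DY.
Let M := Num.max (DX * Lxy / Num.sqrt muy) (DY * Lyx / Num.sqrt mux).
Let mm := Num.min (Num.sqrt muy * dY) (Num.sqrt mux * dX).
Let nu := 1 - Num.sqrt 2 * M / mm.
Let g := dotp (gradx x y) (x - sx) + - dotp (grady x y) (y - sy).
Let eta := nu * g / C.

Let Xxs : X xs. Proof. by case: NE. Qed.
Let Yys : Y ys. Proof. by case: NE. Qed.

Let xs_min u : X u -> f xs ys <= f u ys.
Proof. by case: NE => _ _ + Xu => /(_ u ys Xu Yys)[]. Qed.

Let ys_min v : Y v -> - f xs ys <= - f xs v.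
Proof. by case: NE => _ _ + Yv => /(_ xs v Xxs Yv)[]; rewrite lerN2. Qed.

Let syP' : argmin Y (dotp (- grady x y)) sy.
Proof. by case: syP => Ys smax; split=> // w Yw; rewrite !dotpNl lerN2 smax. Qed.

Lemma nash_gap_ge0 u v : X u -> Y v -> 0 <= f u ys - f xs v.
Proof. by move=> /xs_min ? /ys_min ?; lra. Qed.

Lemma duality_gap_ge0 : 0 <= g.
Proof.
rewrite /g -dotpNl addr_ge0//; [exact: player_gap_ge0 Xx sxP|].
exact: player_gap_ge0 Yy syP'.
Qed.

Lemma duality_gap_le : g <= C.
Proof.
case: sxP syP => Xsx _ [Ysy _].
have := player_gap_ub PX Xxs Yys xs_min (lt_le_trans dX0 dXs) Xx Yy Xsx.
have := player_gap_ub PY Yys Xxs ys_min (lt_le_trans dY0 dYs) Yy Xx Ysy.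
rewrite /g /C -/DX -/DY dotpNl; nra.
Qed.

Hypotheses (muLx : mux <= Lx) (muLy : muy <= Ly).
Hypothesis nu0 : 0 < nu.

Let mux0 : 0 < mux. Proof. exact: (player_mu_gt0 PX). Qed.
Let muy0 : 0 < muy. Proof. exact: (player_mu_gt0 PY). Qed.
Let cX : compact X. Proof. exact: (player_compact PX). Qed.
Let cY : compact Y. Proof. exact: (player_compact PY). Qed.

Let dXD : dX <= DX.
Proof.
apply: le_trans dXs _; apply: dist_boundary_le_diam => //.
exact: lt_le_trans dX0 dXs.
Qed.

Let dYD : dY <= DY.
Proof.
apply: le_trans dYs _; apply: dist_boundary_le_diam => //.
exact: lt_le_trans dY0 dYs.
Qed.

Let DX0 : 0 < DX. Proof. exact: lt_le_trans dX0 dXD. Qed.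
Let DY0 : 0 < DY. Proof. exact: lt_le_trans dY0 dYD. Qed.

Let cross0 : 0 <= (Lxy + Lyx) * DX * DY.
Proof.
rewrite mulr_ge0 ?(ltW DY0)// mulr_ge0 ?(ltW DX0)// addr_ge0//.
  exact: (player_K_ge0 PX).
exact: (player_K_ge0 PY).
Qed.

(** Strict because [Ly * DY ^+ 2 > 0]; it yields both [C > 0] and the positivity of the contraction
    factor. *)
Let self_gt : mux * dX ^+ 2 < Lx * DX ^+ 2 + Ly * DY ^+ 2.
Proof.
have Ly0 : 0 < Ly by exact: lt_le_trans muLy.
have : 0 < Ly * DY ^+ 2 by rewrite mulr_gt0// exprn_gt0.
have : mux * dX ^+ 2 <= Lx * DX ^+ 2.
  by rewrite ler_pM ?(ltW mux0) ?sqr_ge0// lerXn2r// nnegrE ltW.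
lra.
Qed.

Let C0 : 0 < C.
Proof.
rewrite ltr_wpDr//; apply: lt_trans self_gt.
by rewrite mulr_gt0 ?exprn_gt0.
Qed.

Let M0 : 0 <= M.
Proof.
by rewrite /M le_max divr_ge0 ?sqrtr_ge0// mulr_ge0 ?(player_K_ge0 PX) ?(ltW DX0).
Qed.

Let mm0 : 0 < mm. Proof. by rewrite /mm lt_min !mulr_gt0 ?sqrtr_gt0. Qed.

Let nu1 : nu <= 1.
Proof. by rewrite gerBl mulr_ge0 ?mulr_ge0 ?sqrtr_ge0// invr_ge0 ltW. Qed.

Lemma step_size_itv : 0 <= eta <= 1.
Proof.
have g0 := duality_gap_ge0; have gC := duality_gap_le.
rewrite divr_ge0 ?mulr_ge0 ?(ltW nu0) ?(ltW C0)//= ler_pdivrMr// mul1r.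
by apply: le_trans gC; rewrite ler_piMl.
Qed.

Lemma contraction_factor_itv :
  0 < 1 - Num.min (muy * dY ^+ 2) (mux * dX ^+ 2) * nu ^+ 2 / C < 1.
Proof.
set k := Num.min _ _.
have k0 : 0 < k by rewrite lt_min !mulr_gt0 ?exprn_gt0.
have kC : k < C.
  have : k <= mux * dX ^+ 2 by rewrite ge_min lexx orbT.
  by move/le_lt_trans; apply; rewrite (lt_le_trans self_gt)// lerDl.
have nu2 : nu ^+ 2 <= 1 by rewrite expr_le1// ltW.
rewrite subr_gt0 ltrBlDr ltrDl divr_gt0 ?mulr_gt0 ?exprn_gt0// andbT.
by rewrite ltr_pdivrMr// mul1r (le_lt_trans _ kC)// ler_piMr// ltW.
Qed.

Lemma nash_gap_decrease :
  f ((1 - eta) *: x + eta *: sx) ys - f xs ((1 - eta) *: y + eta *: sy) <=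
  (1 - Num.min (muy * dY ^+ 2) (mux * dX ^+ 2) * nu ^+ 2 / C)
    * (f x ys - f xs y).
Proof.
have [[Xsx _] [Ysy _]] := (sxP, syP).
have px := sqr_sqrtr (ltW mux0); have py := sqr_sqrtr (ltW muy0).
have p0 : 0 < Num.sqrt mux by rewrite sqrtr_gt0.
have q0 : 0 < Num.sqrt muy by rewrite sqrtr_gt0.
have -> : Num.min (muy * dY ^+ 2) (mux * dX ^+ 2) = mm ^+ 2.
  rewrite /mm -{1}px -{1}py -!exprMn /Num.min ltr_pXn2r// ?nnegrE ?mulr_ge0 ?ltW//.
  by case: ifP.
apply: (@gap_contraction R (Num.sqrt mux) (Num.sqrt muy) dX dY (DX * Lxy) (DY * Lyx)
  mm M (enorm (x - xs)) (enorm (y - ys)) (enorm (gradx x y)) (enorm (grady x y))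
  _ _ (dotp (gradx x y) (x - xs) + dotp (- grady x y) (y - ys)) g C) => //.
- by rewrite /mm ge_min lexx.
- by rewrite /mm ge_min lexx orbT.
- by rewrite -ler_pdivrMr// le_max lexx.
- by rewrite -ler_pdivrMr// le_max lexx orbT.
- exact: enorm_ge0.
- exact: enorm_ge0.
- exact: enorm_ge0.
- exact: enorm_ge0.
- rewrite px py.
  have := player_growth PX Xxs Yys xs_min Xx.
  have := player_growth PY Yys Xxs ys_min Yy.
  lra.
- rewrite px py.
  have := player_gradient_ub PX Xx Xxs Yy.
  have := player_gradient_ub PY Yy Yys Xx.
  lra.
- apply: lerD; first exact: dotp_le.
  by rewrite -[X in _ <= X * _]enormN; exact: dotp_le.
- have := player_interior_gap x cX Xxs (ltW dX0) dXs sxP.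
  have := player_interior_gap y cY Yys (ltW dY0) dYs syP'.
  rewrite enormN /g !dotpNl; lra.
have := player_step PX Yys Xx Yy Xsx step_size_itv.
have := player_step PY Xxs Yy Xx Ysy step_size_itv.
(* The second-order terms of the two players add up to the squares in [C]; the remaining cross term
   is nonnegative. *)
have := mulr_ge0 (sqr_ge0 eta) cross0.
rewrite -/DX -/DY -/nu -/eta dotpNl /g [in C / 2]/C.
lra.
Qed.

End Game.

(** * The sequence of games *)

Theorem theorem2 (R : realType) (nx ny : nat)
    (X : set 'rV[R]_nx) (Y : set 'rV[R]_ny)
    (f : nat -> 'rV[R]_nx -> 'rV[R]_ny -> R)
    (gradx : nat -> 'rV[R]_nx -> 'rV[R]_ny -> 'rV[R]_nx)
    (grady : nat -> 'rV[R]_nx -> 'rV[R]_ny -> 'rV[R]_ny)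
    (mux muy Lx Ly Lxy Lyx : R)
    (xs : nat -> 'rV[R]_nx) (ys : nat -> 'rV[R]_ny)
    (rho : R)
    (x sx : nat -> 'rV[R]_nx) (y sy : nat -> 'rV[R]_ny) :
  (* (A1) *)
  X !=set0 -> compact X -> convex_set X ->
  Y !=set0 -> compact Y -> convex_set Y ->
  (forall t, {within X `*` Y, continuous
     (fun z : 'rV[R]_nx * 'rV[R]_ny => f t z.1 z.2)}) ->
  (forall t v, Y v -> convex_function X (fun u => f t u v)) ->
  (forall t u, X u -> concave_function Y (fun v => f t u v)) ->
  (* (A2) *)
  0 < mux -> 0 < muy ->
  (forall t v, Y v -> strongly_convex mux X (fun u => f t u v)) ->
  (forall t u, X u -> strongly_concave muy Y (fun v => f t u v)) ->
  (* (A3) *)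
  (forall t u v, X u -> Y v ->
     is_gradient X Y (f t) u v (gradx t u v) (grady t u v)) ->
  mux <= Lx -> muy <= Ly ->
  (forall t u u' v, X u -> X u' -> Y v ->
     enorm (gradx t u v - gradx t u' v) <= Lx * enorm (u - u')) ->
  (forall t u v v', X u -> Y v -> Y v' ->
     enorm (grady t u v - grady t u v') <= Ly * enorm (v - v')) ->
  (* (A4) *)
  0 < Lxy -> 0 < Lyx ->
  (forall t u v v', X u -> Y v -> Y v' ->
     enorm (gradx t u v - gradx t u v') <= Lxy * enorm (v - v')) ->
  (forall t u u' v, X u -> X u' -> Y v ->
     enorm (grady t u v - grady t u' v) <= Lyx * enorm (u - u')) ->
  (* Nash equilibria, uniformly in the interior *)
  (forall t, nash_equilibrium X Y (f t) (xs t) (ys t)) ->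
  (forall t, interior X (xs t)) -> (forall t, interior Y (ys t)) ->
  let deltaX := inf [set dist (xs t) (boundary X) | t in [set: nat]] in
  let deltaY := inf [set dist (ys t) (boundary Y) | t in [set: nat]] in
  0 < deltaX -> 0 < deltaY ->
  let DX := diam X in
  let DY := diam Y in
  let C := Lx * DX ^+ 2 + Ly * DY ^+ 2 + (Lxy + Lyx) * DX * DY in
  let nu := 1 - Num.sqrt 2 *
      Num.max (DX * Lxy / Num.sqrt muy) (DY * Lyx / Num.sqrt mux) /
      Num.min (Num.sqrt muy * deltaY) (Num.sqrt mux * deltaX) in
  0 < nu ->
  0 < rho < 1 ->
  (* online Frank-Wolfe *)
  X (x 0%N) -> Y (y 0%N) ->
  let rx t := gradx t (x t) (y t) in
  let ry t := grady t (x t) (y t) in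
  (forall t, argmin X (dotp (rx t)) (sx t)) ->
  (forall t, argmax Y (dotp (ry t)) (sy t)) ->
  let gx t := dotp (rx t) (x t - sx t) in
  let gy t := - dotp (ry t) (y t - sy t) in
  let g t := gx t + gy t in
  let eta t := nu * g t / C in
  (forall t, x t.+1 = (1 - eta t) *: x t + eta t *: sx t) ->
  (forall t, y t.+1 = (1 - eta t) *: y t + eta t *: sy t) ->
  (* conclusions; Vx, Vy, Fsup are meaningful for t >= 1 *)
  let Vx t := enorm (xs t - xs t.-1) in
  let Vy t := enorm (ys t - ys t.-1) in
  let Fsup t := sup [set `|f t z.1 z.2 - f t.-1 z.1 z.2| | z in X `*` Y] in
  let beta := 1 - Num.min (muy * deltaY ^+ 2) (mux * deltaX ^+ 2) * nu ^+ 2 / C in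
  let gap t := f t (x t) (ys t) - f t (xs t) (y t) in
  let err i := DX * Lyx * Vy i + DY * Lxy * Vx i
      + Ly / 2 * Vy i ^+ 2 + Lx / 2 * Vx i ^+ 2 + 2 * Fsup i in
  let regret T := \sum_(1 <= t < T.+1) rho ^+ (T - t) * gap t in
  [/\ forall t, 0 <= eta t <= 1,
      0 < beta < 1,
      forall t, gap t <= beta ^+ t * gap 0%N
        + \sum_(1 <= i < t.+1) beta ^+ (t - i) * err i,
      forall T, (1 <= T)%N ->
        regret T <= \sum_(1 <= t < T.+1) rho ^+ (T - t) * beta ^+ t * gap 0%N
          + \sum_(1 <= i < T.+1) \sum_(i <= t < T.+1)
              rho ^+ (T - t) * beta ^+ (t - i) * err i
    & Vx @ \oo --> (0 : R) -> Vy @ \oo --> (0 : R) -> Fsup @ \oo --> (0 : R) ->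
      regret @ \oo --> (0 : R)].
Proof.
move=> X0 cX convX Y0 cY convY fcont _ _ mux0 muy0 scX scY fgrad muLx muLy.
move=> lipxx lipyy Lxy0 Lyx0 lipxy lipyx NE _ _ deltaX deltaY dX0 dY0.
move=> DX DY C nu nu0 /andP[rho0 rho1] Xx0 Yy0 rx ry sxP syP gx gy g eta xS yS.
move=> Vx Vy Fsup beta gap err regret.
have Lx0 : 0 <= Lx by exact: le_trans (ltW mux0) muLx.
have Ly0 : 0 <= Ly by exact: le_trans (ltW muy0) muLy.
have PX t : smooth_player X Y (f t) (gradx t) mux Lx Lxy.
  split => //; try exact: ltW.
  - exact: scX.
  - by move=> u v Xu Yv; exact: is_gradient_left (fgrad t u v Xu Yv).
  - exact: lipxx.
  - exact: lipxy.
have PY t : smooth_player Y X (fun v u => - f t u v) (fun v u => - grady t u v)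
    muy Ly Lyx.
  split => //; try exact: ltW.
  - exact: scY.
  - by move=> v u Yv Xu; exact: is_gradient_right (fgrad t u v Xu Yv).
  - by move=> v v' u Yv Yv' Xu; rewrite -opprD enormN lipyy.
  - by move=> v u u' Yv Xu Xu'; rewrite -opprD enormN lipyx.
have deltaX_le t : deltaX <= dist (xs t) (boundary X).
  apply: ge_inf; last by exists t.
  by exists 0 => _ [k _ <-]; apply: dist_ge0.
have deltaY_le t : deltaY <= dist (ys t) (boundary Y).
  apply: ge_inf; last by exists t.
  by exists 0 => _ [k _ <-]; apply: dist_ge0.
have eta01 t : X (x t) -> Y (y t) -> 0 <= eta t <= 1.
  move=> Xxt Yyt.
  exact: (step_size_itv (PX t) (PY t) (NE t) dX0 dY0 (deltaX_le t) (deltaY_le t)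
    Xxt Yyt (sxP t) (syP t) muLx muLy nu0).
(* Induction: feasible iterates at [t] give a step size in [[0, 1]], hence convex combinations that
   are feasible at [t.+1]. *)
have [Xx Yy] : (forall t, X (x t)) /\ (forall t, Y (y t)).
  suff H t : X (x t) /\ Y (y t) by split=> t; case: (H t).
  elim: t => // t [Xxt Yyt].
  have [[Xsx _] [Ysy _]] := (sxP t, syP t).
  rewrite xS yS; split; apply: convex_set_segment => //; exact: eta01.
(* The factor is common to all the games, so the one at time 0 serves. *)
have beta01 : 0 < beta < 1.
  exact: (contraction_factor_itv (PX 0%N) (PY 0%N) (NE 0%N) dX0 dY0
    (deltaX_le 0%N) (deltaY_le 0%N) muLx muLy nu0).
have /andP[beta0 beta1] := beta01.
have Xxs t : X (xs t) by case: (NE t).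
have Yys t : Y (ys t) by case: (NE t).
have gap0 t : 0 <= gap t by exact: (nash_gap_ge0 (NE t)).
have decrease t : f t (x t.+1) (ys t) - f t (xs t) (y t.+1) <= beta * gap t.
  rewrite xS yS.
  exact: (nash_gap_decrease (PX t) (PY t) (NE t) dX0 dY0 (deltaX_le t)
    (deltaY_le t) (Xx t) (Yy t) (sxP t) (syP t) muLx muLy nu0).
(* Pass from [f t.+1] to [f t] at two points, each at cost [Fsup t.+1], then replace the new
   equilibrium by the old one, one player at a time. *)
have gapS t : gap t.+1 <= beta * gap t + err t.+1.
  have xs_min u : X u -> f t (xs t) (ys t) <= f t u (ys t).
    by case: (NE t) => _ _ + Xu => /(_ u _ Xu (Yys t))[].
  have ys_min v : Y v -> - f t (xs t) (ys t) <= - f t (xs t) v.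
    by case: (NE t) => _ _ + Yv => /(_ (xs t) v (Xxs t) Yv)[]; rewrite lerN2.
  have driftx : f t (xs t) (y t.+1) - f t (xs t.+1) (y t.+1) <=
      DY * Lxy * Vx t.+1.
    exact: (player_drift (PX t) (Xxs t) (Yys t) xs_min
      (lt_le_trans dX0 (deltaX_le t)) (Xxs t.+1) (Yy t.+1)).
  have drifty : - f t (x t.+1) (ys t) - - f t (x t.+1) (ys t.+1) <=
      DX * Lyx * Vy t.+1.
    exact: (player_drift (PY t) (Yys t) (Xxs t) ys_min
      (lt_le_trans dY0 (deltaY_le t)) (Yys t.+1) (Xx t.+1)).
  have F u v : X u -> Y v -> `|f t.+1 u v - f t u v| <= Fsup t.+1.
    move=> Xu Yv.
    exact: (ler_sup_dist (z := (u, v)) (compact_setX cX cY) (fcont t.+1) (fcont t)).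
  have := F _ _ (Xx t.+1) (Yys t.+1); have := F _ _ (Xxs t.+1) (Yy t.+1).
  rewrite !ler_norml => /andP[F1 _] /andP[_ F2].
  (* The drift bounds are linear in [Vx] and [Vy]; nonnegativity of the quadratic terms brings them
     below [err]. *)
  have V1 : 0 <= Ly / 2 * Vy t.+1 ^+ 2 by rewrite mulr_ge0 ?sqr_ge0// divr_ge0.
  have V2 : 0 <= Lx / 2 * Vx t.+1 ^+ 2 by rewrite mulr_ge0 ?sqr_ge0// divr_ge0.
  have := decrease t; move: driftx drifty V1 V2.
  rewrite /err /(gap t.+1); lra.
have regretS T : regret T.+1 = rho * regret T + gap T.+1 by exact: discounted_sumS.
have gap_le := affine_recursion_le (ltW beta0) gapS.
split=> //.
- by move=> t; exact: eta01.
- move=> T _; rewrite -sum_triangle_exchange -big_split/=.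
  apply: ler_sum_nat => t _; rewrite -mulrA.
  under eq_bigr do rewrite -mulrA.
  by rewrite -mulr_sumr -mulrDr ler_wpM2l// exprn_ge0// ltW.
- move=> Vx0 Vy0 F0.
  have err0 : err @ \oo --> (0 : R).
    rewrite -[0]addr0; apply: cvgD; last first.
      by rewrite -[0](mulr0 2); apply: cvgMl_tmp.
    have sq0 (c : R) (u : nat -> R) : u @ \oo --> (0 : R) ->
        (fun i => c * u i ^+ 2) @ \oo --> (0 : R).
      move=> u0; rewrite -[0](mulr0 c); apply: cvgMl_tmp.
      by rewrite -[0](mulr0 0); under eq_fun do rewrite expr2; exact: cvgM.
    have lin0 (c : R) (u : nat -> R) : u @ \oo --> (0 : R) ->
        (fun i => c * u i) @ \oo --> (0 : R).
      by move=> u0; rewrite -[0](mulr0 c); apply: cvgMl_tmp.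
    rewrite -[0]addr0; apply: cvgD; last exact: sq0.
    rewrite -[0]addr0; apply: cvgD; last exact: sq0.
    by rewrite -[0]addr0; apply: cvgD; exact: lin0.
  (* Convergence passes from the errors to the gap at rate [beta], then from the gap to the regret
     at rate [rho]; both sequences are nonnegative. *)
  have gap_cvg := affine_recursion_cvg0 (q := beta) _ gap0 gapS err0.
  have regret0 T : 0 <= regret T.
    by apply: sumr_ge0 => i _; rewrite mulr_ge0// exprn_ge0// ltW.
  apply: (affine_recursion_cvg0 (q := rho) (e := gap)) => //.
  + by rewrite ltW.
  + by move=> T; rewrite regretS.
  + by apply: gap_cvg; rewrite ltW.
Qed.
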